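(* Let $m_1,m_2\in\mathbb{N}$, $\eta_1,\eta_2>0$, $\gamma_1,\gamma_2>0$, $0\le\alpha_1,\alpha_2\le1$, $s_1,s_2\in\mathbb{N}\cup\{0\}$, $\phi\in C(I^2)$ with $I^2=[0,1]\times[0,1]$, and $(z,y)\in I^2$. Then $$\left|\Re_{m_1,m_2,\eta_1,\eta_2,\gamma_1,\gamma_2}^{(\alpha_1,\alpha_2,s_1,s_2)}(\phi;z,y)-\phi(z,y)\right|\le 4\,\omega\!\left(\phi,\sqrt{\varphi_{m_1,\eta_1,\gamma_1}^{(\alpha_1,s_1)}(z)},\sqrt{\varphi_{m_2,\eta_2,\gamma_2}^{(\alpha_2,s_2)}(y)}\right),$$ where $\varphi_{m,\eta,\gamma}^{(\alpha,s)}(x)=\Re_{m,\eta,\gamma}^{(\alpha,s)}((t-x)^2;x)$ is the second central moment of the univariate operator, and $\omega(\phi,\cdot,\cdot)$ is the complete modulus of continuity of $\phi$.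
   Context: $\mathbb{N}$ denotes the positive integers; $C[0,1]$ and $C(I^2)$ are the spaces of real-valued continuous functions on $[0,1]$ and $I^2=[0,1]\times[0,1]$. Binomial coefficients are $\binom{a}{b}=\frac{a!}{b!(a-b)!}$ if $0\le b\le a$ and $0$ otherwise; a term whose binomial coefficient is $0$ is understood to be $0$, and $0^0=1$. For $m\in\mathbb{N}$, $0\le j\le m$, $0\le\alpha\le1$, $s\in\mathbb{N}\cup\{0\}$ and $x\in[0,1]$ put: if $m<s$, $$q_{m,j}^{(\alpha,s)}(x)=\binom{m}{j}x^j(1-x)^{m-j};$$ if $m\ge s$, $$q_{m,j}^{(\alpha,s)}(x)=(1-\alpha)\binom{m-s}{j-s}x^{j-s+1}(1-x)^{m-j}+(1-\alpha)\binom{m-s}{j}x^{j}(1-x)^{m-s-j+1}+\alpha\binom{m}{j}x^j(1-x)^{m-j}.$$ Univariate operator ($\eta,\gamma>0$, $f\in C[0,1]$, $\Gamma$ the Gamma function): $$\Re_{m,\eta,\gamma}^{(\alpha,s)}(f;x)=\Gamma(\eta+1)\sum_{j=0}^{m}q_{m,j}^{(\alpha,s)}(x)\int_0^1\frac{(1-t)^{\eta-1}}{\Gamma(\eta)}\,f\!\left(\frac{j+t^{\gamma}}{m+1}\right)dt ;$$ $\Re_{m,\eta,\gamma}^{(\alpha,s)}((t-x)^2;x)$ means this operator applied to $t\mapsto(t-x)^2$ with $x$ fixed, evaluated at $x$. Bivariate operator ($\phi\in C(I^2)$, $(z,y)\in I^2$): $$\Re_{m_1,m_2,\eta_1,\eta_2,\gamma_1,\gamma_2}^{(\alpha_1,\alpha_2,s_1,s_2)}(\phi;z,y)=\Gamma(\eta_1+1)\Gamma(\eta_2+1)\sum_{j_1=0}^{m_1}\sum_{j_2=0}^{m_2}q_{m_1,j_1}^{(\alpha_1,s_1)}(z)\,q_{m_2,j_2}^{(\alpha_2,s_2)}(y)\int_0^1\!\!\int_0^1\frac{(1-t_1)^{\eta_1-1}}{\Gamma(\eta_1)}\frac{(1-t_2)^{\eta_2-1}}{\Gamma(\eta_2)}\,\phi\!\left(\frac{j_1+t_1^{\gamma_1}}{m_1+1},\frac{j_2+t_2^{\gamma_2}}{m_2+1}\right)dt_1\,dt_2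 .$$ The complete modulus of continuity (two-parameter form) is, for $\rho_1,\rho_2>0$, $$\omega(\phi,\rho_1,\rho_2)=\sup\{|\phi(v_1,v_2)-\phi(z,y)|:(v_1,v_2),(z,y)\in I^2,\ |v_1-z|\le\rho_1,\ |v_2-y|\le\rho_2\}.$$ *)

(* Defs.v *)
From mathcomp Require Import all_boot all_order all_algebra.
From mathcomp Require Import all_classical all_reals all_analysis.
Set Implicit Arguments.
Unset Strict Implicit.
Unset Printing Implicit Defensive.
Import Order.TTheory GRing.Theory Num.Theory.
Import numFieldNormedType.Exports.
Local Open Scope classical_set_scope.
Local Open Scope ring_scope.

(* All integrals are Lebesgue integrals: for eta < 1 the kernel
   (1 - t) `^ (eta - 1) is unbounded near t = 1. *)
Definition Gamma {R : realType} (a : R) : R :=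
  \int[@lebesgue_measure R]_(t in `]0, +oo[) (t `^ (a - 1) * expR (- t)).

(* The test s <= j encodes the convention that binom(m-s, j-s) = 0 for j < s,
   which the truncated subtraction j - s would break. In the second summand,
   'C(m - s, j) = 0 whenever the exponent m - s - j + 1 gets truncated. *)
Definition q_basis {R : realType} (alpha : R) (s m j : nat) (x : R) : R :=
  if (m < s)%N then 'C(m, j)%:R * x ^+ j * (1 - x) ^+ (m - j)
  else
    (1 - alpha) *
      (if (s <= j)%N
       then 'C(m - s, j - s)%:R * x ^+ (j - s + 1) * (1 - x) ^+ (m - j)
       else 0)
    + (1 - alpha) * 'C(m - s, j)%:R * x ^+ j * (1 - x) ^+ (m - s - j + 1)
    + alpha * 'C(m, j)%:R * x ^+ j * (1 - x) ^+ (m - j).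

Definition frac_kernel {R : realType} (eta t : R) : R :=
  (1 - t) `^ (eta - 1) / Gamma eta.

Definition node {R : realType} (m j : nat) (gamma t : R) : R :=
  (j%:R + t `^ gamma) / m.+1%:R.

Definition op1 {R : realType} (m : nat) (eta gamma alpha : R) (s : nat)
    (f : R -> R) (x : R) : R :=
  Gamma (eta + 1) * \sum_(0 <= j < m.+1) q_basis alpha s m j x *
    \int[@lebesgue_measure R]_(t in `[0, 1])
      (frac_kernel eta t * f (node m j gamma t)).

Definition op2 {R : realType} (m1 m2 : nat) (eta1 eta2 gamma1 gamma2 : R)
    (alpha1 alpha2 : R) (s1 s2 : nat) (phi : R * R -> R) (z y : R) : R :=
  Gamma (eta1 + 1) * Gamma (eta2 + 1) *
  \sum_(0 <= j1 < m1.+1) \sum_(0 <= j2 < m2.+1)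
    q_basis alpha1 s1 m1 j1 z * q_basis alpha2 s2 m2 j2 y *
    \int[@lebesgue_measure R]_(t2 in `[0, 1])
      \int[@lebesgue_measure R]_(t1 in `[0, 1])
        (frac_kernel eta1 t1 * frac_kernel eta2 t2 *
         phi (node m1 j1 gamma1 t1, node m2 j2 gamma2 t2)).

Definition second_central_moment {R : realType} (m : nat) (eta gamma alpha : R)
    (s : nat) (x : R) : R :=
  op1 m eta gamma alpha s (fun t => (t - x) ^+ 2) x.

Definition unit_square {R : realType} : set (R * R) := `[0, 1] `*` `[0, 1].

Definition complete_modulus {R : realType} (phi : R * R -> R) (rho1 rho2 : R)
    : R :=
  sup [set d | exists v w : R * R,
    [/\ unit_square v, unit_square w,
        `|v.1 - w.1| <= rho1, `|v.2 - w.2| <= rho2 &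
        d = `|phi v - phi w|]].

(* Main.v *)
Require Import Defs.
From mathcomp Require Import all_boot all_order all_algebra.
From mathcomp Require Import all_classical all_reals all_analysis.
From mathcomp Require Import measurable_realfun ring lra.
Set Implicit Arguments.
Unset Strict Implicit.
Unset Printing Implicit Defensive.
Import Order.TTheory GRing.Theory Num.Theory.
Import numFieldNormedType.Exports.
Local Open Scope classical_set_scope.
Local Open Scope ring_scope.

(* Write L1 and L2 for the univariate operators in z and y. Each is positive and
   linear, and L 1 = 1 because the q_j sum to 1, the kernel integrates to
   1 / (eta Gamma(eta)) and Gamma(eta + 1) = eta Gamma(eta). Each second central
   moment delta is positive, as the nodes are injective in t. Cutting
   the segment from (z, y) to (u, v) into short pieces gives, with
   rho1 ^ 2 = delta1 and rho2 ^ 2 = delta2,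
     |phi(u, v) - phi(z, y)|
       <= omega(phi, rho1, rho2) (1 + (u - z)^2 / delta1) (1 + (v - y)^2 / delta2).
   The bivariate operator is L2 applied in v to L1 applied in u, and each factor
   on the right has mean 1 + delta / delta = 2, whence the constant 4. *)

(** * Improper integrals and the Gamma function *)

(* Splitting the derivative as [f - g] with [f] and [g] nonnegative avoids any
   integrability hypothesis. *)
Lemma ge0_FTC_exhaustion (R : realType) (f g F : R -> R) (a b : R^nat) (A B : R) :
  nonincreasing_seq a -> nondecreasing_seq b -> (forall n, a n < b n) ->
  let D := \bigcup_n `[a n, b n]%classic in
  (forall x, D x -> 0 <= f x) -> (forall x, D x -> 0 <= g x) ->
  (forall x, D x -> {for x, continuous f}) ->
  (forall x, D x -> {for x, continuous g}) ->
  (forall x, D x -> is_derive x 1 F (f x - g x)) ->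
  F (a n) @[n --> \oo] --> A -> F (b n) @[n --> \oo] --> B ->
  (\int[@lebesgue_measure R]_(x in D) (f x)%:E =
   \int[@lebesgue_measure R]_(x in D) (g x)%:E + (B - A)%:E)%E.
Proof.
move=> na nb ab D f0 g0 cf cg dF FA FB.
have sD n : `[a n, b n]%classic `<=` D by move=> x abx; exists n.
have ndI : nondecreasing_seq (fun n => `[a n, b n]%classic).
  move=> m n mn; rewrite subsetEset; apply: subset_itv; rewrite bnd_simp.
  - exact: na.
  - exact: nb.
have cW (h : R -> R) n : (forall x, D x -> {for x, continuous h}) ->
    {within `[a n, b n], continuous h}.
  by move=> ch; apply: continuous_in_subspaceT => x /set_mem xn; exact/ch/(sD n).
have mW (h : R -> R) n : (forall x, D x -> {for x, continuous h}) ->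
    measurable_fun `[a n, b n] (fun x => (h x)%:E).
  move=> ch; apply/measurable_EFinP.
  by apply: subspace_continuous_measurable_fun => //; exact: cW.
have iW (h : R -> R) n : (forall x, D x -> {for x, continuous h}) ->
    (@lebesgue_measure R).-integrable `[a n, b n] (EFin \o h).
  move=> ch; apply: continuous_compact_integrable; first exact: segment_compact.
  exact: cW.
(* Monotone convergence along the increasing segments; the limit may be infinite. *)
have cvgI (h : R -> R) : (forall x, D x -> 0 <= h x) ->
    (forall x, D x -> {for x, continuous h}) ->
    (\int[@lebesgue_measure R]_(x in `[a n, b n]) (h x)%:E @[n --> \oo] -->
     \int[@lebesgue_measure R]_(x in D) (h x)%:E)%E.
  move=> h0 ch; apply: ge0_nondecreasing_set_cvg_integral => //.
  - by move=> n; exact: mW.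
  - by move=> n x nx; rewrite lee_fin; exact/h0/(sD n).
(* On a segment all terms are finite, so the integral of [g] can be moved to the right. In this
   additive form the identity passes to the limit even when the integrals become infinite. *)
have FTC n : (\int[@lebesgue_measure R]_(x in `[a n, b n]) (f x)%:E =
    \int[@lebesgue_measure R]_(x in `[a n, b n]) (g x)%:E
      + (F (b n) - F (a n))%:E)%E.
  have dFx x : x \in `[a n, b n] -> derivable F x 1.
    by move=> xn; apply: ex_derive; apply: dF; exact: (sD n).
  have cF x : x \in `[a n, b n] -> F @ x --> F x.
    by move=> /dFx ?; exact/differentiable_continuous/derivable1_diffP.
  have := @continuous_FTC2 R (fun x => f x - g x) F (a n) (b n) (ab n).
  rewrite EFinB => <-.
  - under [X in (_ + X)%E]eq_integral do rewrite EFinB.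
    rewrite integralB_EFin//; [|exact: iW|exact: iW].
    by rewrite addeC subeK// integrable_fin_num//; exact: iW.
  - by apply: cW => x Dx; apply: continuousB; [exact: cf|exact: cg].
  - split.
    + by move=> x /subset_itv_oo_cc; exact: dFx.
    + by apply/cvg_at_right_filter/cF; rewrite in_itv/= lexx ltW.
    + by apply/cvg_at_left_filter/cF; rewrite in_itv/= lexx ltW.
  - move=> x /subset_itv_oo_cc xn; rewrite derive1E.
    by apply: derive_val; apply: dF; exact: (sD n).
have := cvgI _ f0 cf; under eq_fun do rewrite FTC.
move=> cvgf; apply: (cvg_unique _ cvgf) => //.
apply: cvgeD; [by rewrite fin_num_adde_defl|exact: cvgI|].
by apply: cvg_EFin; [exact: nearW|apply: cvgB].
Qed.

(** The index starts at 2 so that 1/(n+2) < 1 < n+2: every segment is nondegenerate, as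
    [ge0_FTC_exhaustion] requires. *)
Lemma bigcup_itvoy (R : realType) :
  \bigcup_n `[n.+2%:R^-1, n.+2%:R]%classic = `]0 : R, +oo[%classic.
Proof.
apply/seteqP; split=> [x [n _] /=|x /=]; rewrite !in_itv/= ?andbT.
  by case/andP=> nx _; apply: lt_le_trans nx; rewrite invr_gt0.
move=> x0; pose n := maxn (Num.trunc x) (Num.trunc x^-1).
have le_n (r : R) : (Num.trunc r <= n)%N -> r <= n.+2%:R.
  move=> rn; apply: ltW; apply: (lt_le_trans (truncnS_gt r)).
  by rewrite ler_nat ltnS (leq_trans rn).
exists n => //=; rewrite in_itv/=; apply/andP; split.
  by rewrite -[leRHS]invrK lef_pV2 ?posrE ?invr_gt0//; apply/le_n/leq_maxr.
exact/le_n/leq_maxl.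
Qed.

(** Divided by p^p, this is the exponential of p ln(x/p) <= p (x/p - 1), an instance of ln u <= u -
    1. *)
Lemma powR_le_expR (R : realType) (p x : R) : 0 < p -> 0 < x ->
  x `^ p <= p `^ p * expR (x - p).
Proof.
move=> p0 x0; have xp0 : 0 < x / p by rewrite divr_gt0.
have -> : x `^ p = p `^ p * (x / p) `^ p.
  by rewrite -powRM ?ltW// mulrC divfK ?gt_eqF.
rewrite ler_wpM2l ?powR_ge0// [leLHS]/powR gt_eqF// ler_expR.
have -> : x - p = p * (x / p - 1) by rewrite mulrBr mulr1 mulrC divfK ?gt_eqF.
apply: ler_wpM2l; first exact: ltW.
rewrite -ler_expR lnK//.
by rewrite (le_trans _ (expR_ge1Dx _))// addrC subrK.
Qed.

(** The bound [powR_le_expR] taken at 1 + x. The shift keeps the majorant bounded near x = 0, while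
    it decays like a power at infinity. *)
Lemma powR_expRN_le (R : realType) (p x : R) : 0 < p -> 0 <= x ->
  expR (- x) <= p `^ p * expR (1 - p) / (1 + x) `^ p.
Proof.
move=> p0 x0; have x1 : 0 < 1 + x by rewrite ltr_wpDr.
rewrite ler_pdivlMr ?powR_gt0// mulrC -ler_pdivlMr ?expR_gt0//.
rewrite -expRN opprK -mulrA -expRD.
have -> : 1 - p + x = 1 + x - p by rewrite addrAC.
exact: powR_le_expR.
Qed.

(** A zero integral would make [f] vanish almost everywhere on [D], which would place [E] inside a
    null set. *)
Lemma Rintegral_gt0 (R : realType) (D E : set R) (f : R -> R) :
  measurable D -> measurable E -> E `<=` D -> (0 < @lebesgue_measure R E)%E ->
  (@lebesgue_measure R).-integrable D (EFin \o f) ->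
  (forall x, D x -> 0 <= f x) -> (forall x, E x -> 0 < f x) ->
  0 < \int[@lebesgue_measure R]_(x in D) f x.
Proof.
move=> mD mE ED E0 intf f0 fE0; rewrite lt_neqAle Rintegral_ge0// andbT.
apply/negP => /eqP int0.
have mf : measurable_fun D (fun x => (f x)%:E) by exact: measurable_int intf.
have : (\int[@lebesgue_measure R]_(x in D) `|(f x)%:E| = 0)%E.
  under eq_integral => x /set_mem Dx do rewrite gee0_abs ?lee_fin ?f0//.
  by rewrite -[LHS]fineK ?integrable_fin_num// -[fine _]int0.
move/(ae_eq_integral_abs (@lebesgue_measure R) mD mf).1 => [N [mN N0 DfN]].
have EN : E `<=` N.
  move=> x Ex; apply: DfN => /= /(_ (ED _ Ex)) [fx0].
  by have := fE0 _ Ex; rewrite fx0 ltxx.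
have := le_measure (@lebesgue_measure R) (mem_set mE) (mem_set mN) EN.
by move=> /(lt_le_trans E0); rewrite [X in (_ < X)%E]N0 ltxx.
Qed.

Lemma continuous_powR (R : realType) (p x : R) : 0 < x ->
  {for x, continuous (fun t => t `^ p)}.
Proof.
move=> x0; apply/differentiable_continuous/derivable1_diffP/derivable_powR.
by rewrite in_itv/= x0.
Qed.

Lemma continuous_expRN (R : realType) (x : R) :
  {for x, continuous (fun t => expR (- t))}.
Proof.
apply: continuous_comp; first exact: continuousN.
exact: continuous_expR.
Qed.

Lemma cvg_natSV (R : realType) (k : nat) :
  ((n + k).+1%:R^-1 : R) @[n --> \oo] --> 0.
Proof. by have := @cvg_harmonic R; rewrite -(cvg_shiftn k). Qed.

Lemma measurable_gamma_integrand (R : realType) (a : R) (D : set R) :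
  measurable_fun D (fun t : R => t `^ (a - 1) * expR (- t)).
Proof.
apply: measurable_funTS; apply: measurable_funM; first exact: measurable_powR.
by apply: continuous_measurable_fun => x; exact: continuous_expRN.
Qed.

Lemma integral_gamma_lty (R : realType) (a : R) : 0 < a ->
  (\int[@lebesgue_measure R]_(t in `]0%R, +oo[) (t `^ (a - 1) * expR (- t))%:E
    < +oo)%E.
Proof.
move=> a0; pose f (t : R) := a * t `^ (a - 1) / (1 + t) `^ (a + 1).
(* [f] dominates the integrand and has the bounded antiderivative [F]. *)
pose F (t : R) := (1 - (1 + t)^-1) `^ a.
have cf (x : R) : 0 < x -> {for x, continuous f}.
  move=> x0; have x1 : 0 < 1 + x by rewrite addr_gt0.
  apply: continuousM.
    by apply: continuousM; [exact: cvg_cst|exact: continuous_powR].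
  apply: continuousV; first by rewrite gt_eqF// powR_gt0.
  apply: (@continuous_comp _ _ _ (fun t : R => 1 + t) (fun t : R => t `^ (a + 1))).
    by apply: continuousD; [exact: cvg_cst|exact: cvg_id].
  exact: continuous_powR.
have intf : (\int[@lebesgue_measure R]_(t in `]0%R, +oo[) (f t)%:E = 1)%E.
  rewrite -bigcup_itvoy.
  (* The value 1 is the difference of the limits 1 and 0 of [F] at the two ends; the subtracted
     function is 0. *)
  transitivity (\int[@lebesgue_measure R]_(t in
      \bigcup_n `[n.+2%:R^-1%R, n.+2%:R%R]%classic) 0%:E + (1 - 0)%:E)%E; last first.
    by rewrite integral0 add0e subr0.
  apply: (@ge0_FTC_exhaustion R f (fun=> 0) F).
  - move=> m n mn; rewrite lef_pV2 ?posrE// ler_nat.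
    by rewrite !ltnS.
  - by move=> m n mn; rewrite ler_nat !ltnS.
  - by move=> n; rewrite (@le_lt_trans _ _ 1)// ?ltr1n// invf_le1// ler1n.
  - rewrite bigcup_itvoy => x /=; rewrite in_itv/= andbT => x0.
    by rewrite divr_ge0 ?mulr_ge0 ?powR_ge0// ltW.
  - by [].
  - rewrite bigcup_itvoy => x /=; rewrite in_itv/= andbT => x0.
    exact: cf.
  - by move=> x _; exact: cvg_cst.
  - rewrite bigcup_itvoy => x /=; rewrite in_itv/= andbT => x0.
    have x1 : 0 < 1 + x by rewrite addr_gt0.
    have E1 : 1 - (1 + x)^-1 = x / (1 + x).
      by field; rewrite gt_eqF.
    have y0 : 0 < 1 - (1 + x)^-1 by rewrite E1 divr_gt0.
    have dG : is_derive x 1 (fun t : R => 1 - (1 + t)^-1) ((1 + x) ^- 2).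
      have dV : is_derive x 1 (fun t : R => 1 + t) 1.
        have := is_deriveD (is_derive_cst (1 : R) x (1 : R)) (is_derive_id x (1 : R)).
        by rewrite add0r.
      have nz : 1 + x != 0 by rewrite gt_eqF.
      have := is_deriveV nz dV.
      move=> /(is_deriveB (is_derive_cst (1 : R) x (1 : R))).
      by rewrite sub0r scaleNr opprK /GRing.scale/= mulr1.
    have := @is_derive1_comp _ (fun u => u `^ a) (fun t => 1 - (1 + t)^-1) x _ _
      (is_derive1_powR a y0) dG.
    rewrite subr0 /F => dF; apply: is_derive_eq dF _.
    have EV : (x / (1 + x)) `^ (a - 1) = x `^ (a - 1) / (1 + x) `^ (a - 1).
      rewrite powRM ?invr_ge0 ?(ltW x0) ?(ltW x1)//.
      by rewrite -(powR_inv1 (ltW x1)) -powRrM mulN1r powRN.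
    have ED : (1 + x) `^ (a + 1) = (1 + x) `^ (a - 1) * (1 + x) ^+ 2.
      rewrite -(powR_mulrn 2 (ltW x1)) -powRD; last by rewrite (gt_eqF x1) implybT.
      by congr (_ `^ _); lra.
    rewrite /f E1 EV ED; field.
    by rewrite !gt_eqF ?powR_gt0.
  (* At t = 1/(n+2) the base 1 - 1/(1 + t) equals 1/(n+3). *)
  - rewrite (_ : (fun n => F _) = (fun n => (n.+3%:R^-1) `^ a)); last first.
      apply/funext => n /=; rewrite /F; congr (_ `^ _).
      rewrite -[n.+3%:R]natr1; have : 0 < n.+2%:R :> R by [].
      by move: (n.+2%:R) => r r0; field; rewrite !gt_eqF ?addr_gt0.
    have /cvg_at_rightP : (t : R) `^ a @[t --> 0^'+] --> 0 by exact: powR_cvg0.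
    apply; split; first by move=> n; rewrite invr_gt0.
    by have := @cvg_natSV R 2; under eq_fun do rewrite addn2.
  - have p1 : 1 `^ a = 1 :> R by rewrite powR1.
    rewrite -[X in _ --> X]p1.
    have c1 : {for 1, continuous (fun t : R => t `^ a)} by exact: continuous_powR.
    apply: (continuous_cvg _ c1).
    rewrite -[X in _ --> X]subr0; apply: cvgB; first exact: cvg_cst.
    under eq_fun do rewrite nat1r.
    by have := @cvg_natSV R 2; under eq_fun do rewrite addn2.
(* The constant of [powR_expRN_le] for p = a + 1, divided by the factor a that [f] carries. *)
pose C := (a + 1) `^ (a + 1) * expR (1 - (a + 1)) / a.
have C0 : 0 <= C by rewrite divr_ge0 ?mulr_ge0 ?powR_ge0 ?expR_ge0 ?ltW.
have fC (t : R) : 0 < t -> t `^ (a - 1) * expR (- t) <= C * f t.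
  move=> t0.
  have -> : C * f t =
    t `^ (a - 1) * ((a + 1) `^ (a + 1) * expR (1 - (a + 1)) / (1 + t) `^ (a + 1)).
    rewrite /f; have : 0 < (1 + t) `^ (a + 1) by rewrite powR_gt0// addr_gt0.
    by move: ((1 + t) `^ (a + 1)) => p p0; rewrite /C; field; rewrite !gt_eqF.
  by rewrite ler_wpM2l ?powR_ge0// powR_expRN_le// ?addr_gt0// ltW.
have f0 (t : R) : 0 <= f t by rewrite divr_ge0 ?mulr_ge0 ?powR_ge0// ltW.
have mf : measurable_fun (`]0%R, +oo[%classic : set R) f.
  apply: subspace_continuous_measurable_fun => //.
  apply: continuous_in_subspaceT => x /set_mem/=; rewrite in_itv/= andbT.
  exact: cf.
have mEf : measurable_fun (`]0%R, +oo[%classic : set R) (fun t => (f t)%:E).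
  exact/measurable_EFinP.
have mgam : measurable_fun (`]0%R, +oo[%classic : set R)
    (fun t => (t `^ (a - 1) * expR (- t))%:E).
  by apply/measurable_EFinP; exact: measurable_gamma_integrand.
have mCf : measurable_fun (`]0%R, +oo[%classic : set R) (fun t => (C * f t)%:E).
  by apply/measurable_EFinP; apply: measurable_funM.
apply: (@le_lt_trans _ _
    (\int[@lebesgue_measure R]_(t in `]0%R, +oo[) (C * f t)%:E)%E).
  apply: ge0_le_integral => //.
  - by move=> t _; rewrite lee_fin mulr_ge0 ?powR_ge0 ?expR_ge0.
  - by move=> t /=; rewrite in_itv/= andbT lee_fin => /fC.
under eq_integral do rewrite EFinM.
rewrite ge0_integralZl// ?intf ?mule1 ?ltry//.
by move=> t _; rewrite lee_fin.
Qed.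

Lemma integrable_gamma (R : realType) (a : R) : 0 < a ->
  (@lebesgue_measure R).-integrable `]0%R, +oo[
    (EFin \o (fun t => t `^ (a - 1) * expR (- t))).
Proof.
move=> a0; apply/integrableP; split.
  by apply/measurable_EFinP; exact: measurable_gamma_integrand.
under eq_integral => t _.
  rewrite gee0_abs; last by rewrite lee_fin mulr_ge0 ?powR_ge0 ?expR_ge0.
  over.
exact: integral_gamma_lty.
Qed.

Lemma Gamma_gt0 (R : realType) (a : R) : 0 < a -> 0 < Gamma a.
Proof.
move=> a0; apply: (@Rintegral_gt0 _ _ `]0%R, 1%R[) => //.
- by move=> x /=; rewrite !in_itv/= => /andP[->].
- by rewrite lebesgue_measure_itv/= lte_fin ltr01 sube0 lte_fin.
- exact: integrable_gamma.
- by move=> t _; rewrite mulr_ge0 ?powR_ge0 ?expR_ge0.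
- move=> t /=; rewrite in_itv/= => /andP[t0 _].
  by rewrite mulr_gt0 ?powR_gt0 ?expR_gt0.
Qed.

(** Integration by parts: the derivative of -t^a e^(-t) is the difference of the two integrands, and
    the boundary terms vanish at 0 and at infinity. *)
Lemma Gamma_add1 (R : realType) (a : R) : 0 < a -> Gamma (a + 1) = a * Gamma a.
Proof.
move=> a0; pose f (t : R) := t `^ (a + 1 - 1) * expR (- t).
pose g (t : R) := a * (t `^ (a - 1) * expR (- t)).
suff fg : (\int[@lebesgue_measure R]_(t in `]0%R, +oo[) (f t)%:E =
    \int[@lebesgue_measure R]_(t in `]0%R, +oo[) (g t)%:E)%E.
  rewrite /Gamma -RintegralZl//; last exact: integrable_gamma.
  by rewrite /Rintegral; congr fine.
pose F (t : R) := - (t `^ a * expR (- t)).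
have cvgF (u : R^nat) :
    u n `^ a * expR (- u n) @[n --> \oo] --> 0 -> F (u n) @[n --> \oo] --> 0.
  by move=> /cvgN; rewrite oppr0.
rewrite -bigcup_itvoy.
transitivity (\int[@lebesgue_measure R]_(t in
    \bigcup_n `[n.+2%:R^-1%R, n.+2%:R%R]%classic) (g t)%:E + (0 - 0)%:E)%E; last first.
  by rewrite subr0 adde0.
apply: (@ge0_FTC_exhaustion R f g F).
- by move=> m n mn; rewrite lef_pV2 ?posrE// ler_nat !ltnS.
- by move=> m n mn; rewrite ler_nat !ltnS.
- by move=> n; rewrite (@le_lt_trans _ _ 1)// ?ltr1n// invf_le1// ler1n.
- by move=> x _; rewrite mulr_ge0 ?powR_ge0 ?expR_ge0.
- by move=> x _; rewrite !mulr_ge0 ?powR_ge0 ?expR_ge0 ?ltW.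
- rewrite bigcup_itvoy => x /=; rewrite in_itv/= andbT => x0.
  by apply: continuousM; [exact: continuous_powR|exact: continuous_expRN].
- rewrite bigcup_itvoy => x /=; rewrite in_itv/= andbT => x0.
  apply: continuousM; first exact: cvg_cst.
  by apply: continuousM; [exact: continuous_powR|exact: continuous_expRN].
- rewrite bigcup_itvoy => x /=; rewrite in_itv/= andbT => x0.
  have dE : is_derive x 1 (fun t : R => expR (- t)) (- expR (- x)).
    have := @is_derive1_comp _ expR (fun t => - t) x _ _ (is_derive_expR (- x))
      (is_deriveN (is_derive_id x (1 : R))).
    by rewrite mulrN1.
  have := is_deriveN (is_deriveM (is_derive1_powR a x0) dE).
  move=> dF; apply: is_derive_eq dF _.
  rewrite /f /g addrK /GRing.scale/=; ring.
- apply: cvgF => //.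
  apply: (@squeeze_cvgr _ _ _ _ (cst 0) (fun n => n.+2%:R^-1 `^ a)).
  + near=> n; rewrite mulr_ge0 ?powR_ge0 ?expR_ge0//=.
    by rewrite ler_piMr ?powR_ge0// -expR0 ler_expR oppr_le0.
  + exact: cvg_cst.
  + have /cvg_at_rightP : (t : R) `^ a @[t --> 0^'+] --> 0 by exact: powR_cvg0.
    apply; split; first by move=> n; rewrite invr_gt0.
    by have := @cvg_natSV R 1; under eq_fun do rewrite addn1.
- apply: cvgF => //.
  (* Since e^(-t) <= C / (1 + t)^(a+1), the boundary term at t = n+2 is at most C (n+2)^a /
     (n+3)^(a+1) <= C / (n+3). *)
  pose C := (a + 1) `^ (a + 1) * expR (1 - (a + 1)).
  apply: (@squeeze_cvgr _ _ _ _ (cst 0) (fun n => C * n.+3%:R^-1)).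
  + near=> n; rewrite mulr_ge0 ?powR_ge0 ?expR_ge0//=.
    have n0 : 0 <= n.+2%:R :> R by [].
    have /(ler_wpM2l (powR_ge0 n.+2%:R a)) : expR (- n.+2%:R) <= _ :=
      powR_expRN_le (addr_gt0 a0 ltr01) n0.
    move=> /le_trans; apply.
    rewrite -/C nat1r powRD ?powRr1 ?pnatr_eq0 ?implybT// mulrCA.
    rewrite ler_wpM2l ?mulr_ge0 ?powR_ge0 ?expR_ge0//.
    rewrite invfM mulrA ler_piMl ?invr_ge0// ler_pdivrMr ?powR_gt0// mul1r.
    by rewrite ge0_ler_powR ?ltW// ?nnegrE// ltr_nat.
  + exact: cvg_cst.
  + rewrite -[X in _ --> X](mulr0 C); apply: cvgM; first exact: cvg_cst.
    by have := @cvg_natSV R 2; under eq_fun do rewrite addn2.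
Unshelve. all: end_near. Qed.

(** * The univariate operator *)

(** The segments stay away from 1, where the kernel may be unbounded. *)
Lemma bigcup_itv01 (R : realType) :
  \bigcup_n `[0, 1 - n.+2%:R^-1]%classic = `[0 : R, 1[%classic.
Proof.
apply/seteqP; split=> [x [n _] /=|x /=]; rewrite !in_itv/=.
  by case/andP=> -> /le_lt_trans; apply; rewrite gtrBl invr_gt0.
case/andP=> x0 x1; have x1' : 0 < 1 - x by rewrite subr_gt0.
exists (Num.trunc (1 - x)^-1) => //=; rewrite in_itv/= x0 lerBrDr addrC -lerBrDr.
rewrite -[leRHS]invrK lef_pV2 ?posrE ?invr_gt0//.
apply: ltW; apply: (lt_le_trans (truncnS_gt (1 - x)^-1)).
by rewrite ler_nat.
Qed.

Lemma frac_kernel_ge0 (R : realType) (eta t : R) :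
  0 < eta -> 0 <= frac_kernel eta t.
Proof. by move=> eta0; rewrite divr_ge0 ?powR_ge0// ltW// Gamma_gt0. Qed.

Lemma measurable_frac_kernel (R : realType) (eta : R) (D : set R) :
  measurable_fun D (frac_kernel eta).
Proof.
apply: measurable_funTS; apply: measurable_funM => //.
apply: (@measurableT_comp _ _ _ _ _ _ (fun u : R => u `^ (eta - 1)) _
  (fun t : R => 1 - t)); first exact: measurable_powR.
by apply: measurable_funB.
Qed.

(** The antiderivative -(1 - t)^eta / Gamma(eta + 1) rises from -1/Gamma(eta + 1) at 0 to 0 at 1;
    the functional equation of Gamma identifies its derivative with the kernel. *)
Lemma integral_frac_kernel (R : realType) (eta : R) : 0 < eta ->
  (\int[@lebesgue_measure R]_(t in `[0%R, 1%R]) (frac_kernel eta t)%:E =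
   ((Gamma (eta + 1))^-1)%:E)%E.
Proof.
move=> eta0; have G0 := Gamma_gt0 eta0.
rewrite -integral_itv_bndo_bndc; last first.
  by apply/measurable_EFinP; exact: measurable_frac_kernel.
rewrite -bigcup_itv01; pose c := (Gamma (eta + 1))^-1.
pose F (t : R) := - c * (1 - t) `^ eta.
transitivity (\int[@lebesgue_measure R]_(t in
    \bigcup_n `[0%R, (1 - n.+2%:R^-1)%R]%classic) 0%:E + (0 - - c)%:E)%E; last first.
  by rewrite integral0 add0e sub0r opprK.
apply: (@ge0_FTC_exhaustion R (frac_kernel eta) (fun=> 0) F (fun=> 0)) => //.
- by move=> m n mn; rewrite lerB// lef_pV2 ?posrE// ler_nat !ltnS.
- by move=> n; rewrite subr_gt0 invf_lt1// ltr1n.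
- by move=> x _; exact: frac_kernel_ge0.
- rewrite bigcup_itv01 => x /=; rewrite in_itv/= => /andP[_ x1].
  apply: continuousM; last exact: cvg_cst.
  apply: (@continuous_comp _ _ _ (fun t : R => 1 - t) (fun t : R => t `^ (eta - 1))).
    by apply: continuousB; [exact: cvg_cst|exact: cvg_id].
  by apply: continuous_powR; rewrite subr_gt0.
- by move=> x _; exact: cvg_cst.
- rewrite bigcup_itv01 => x /=; rewrite in_itv/= => /andP[_ x1].
  have y0 : 0 < 1 - x by rewrite subr_gt0.
  have dB : is_derive x 1 (fun t : R => 1 - t) (-1).
    have := is_deriveB (is_derive_cst (1 : R) x (1 : R)) (is_derive_id x (1 : R)).
    by rewrite sub0r.
  have := @is_derive1_comp _ (fun u => u `^ eta) (fun t => 1 - t) x _ _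
    (is_derive1_powR eta y0) dB.
  move=> /(is_deriveZ (- c)) dF; apply: is_derive_eq dF _.
  rewrite subr0 /frac_kernel /c Gamma_add1// /GRing.scale/=; field.
  by rewrite !gt_eqF.
- by rewrite /F subr0 powR1 mulr1; exact: cvg_cst.
- rewrite /F -[X in _ --> X](mulr0 (- c)); apply: cvgM; first exact: cvg_cst.
  have /cvg_at_rightP : (t : R) `^ eta @[t --> 0^'+] --> 0 by exact: powR_cvg0.
  apply; split; first by move=> n; rewrite subKr invr_gt0.
  under eq_fun do rewrite subKr.
  by have := @cvg_natSV R 1; under eq_fun do rewrite addn1.
Qed.

Lemma integrable_frac_kernel (R : realType) (eta : R) : 0 < eta ->
  (@lebesgue_measure R).-integrable `[0%R, 1%R] (EFin \o frac_kernel eta).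
Proof.
move=> eta0; apply/integrableP; split.
  by apply/measurable_EFinP; exact: measurable_frac_kernel.
under eq_integral => t _ do rewrite gee0_abs ?lee_fin ?frac_kernel_ge0//.
by rewrite integral_frac_kernel// ltry.
Qed.

Lemma node_itv (R : realType) (m j : nat) (gamma t : R) :
  0 <= gamma -> (j <= m)%N -> 0 <= t <= 1 -> 0 <= node m j gamma t <= 1.
Proof.
move=> gamma0 jm /andP[t0 t1]; rewrite divr_ge0 ?addr_ge0 ?powR_ge0//=.
rewrite ler_pdivrMr// mul1r -natr1 lerD ?ler_nat//.
have p1 : 1 `^ gamma = 1 :> R by rewrite powR1.
by rewrite -[leRHS]p1 ge0_ler_powR ?nnegrE.
Qed.

Lemma measurable_node (R : realType) (m j : nat) (gamma : R) (D : set R) :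
  measurable_fun D (node m j gamma).
Proof.
apply: measurable_funTS; apply: measurable_funM => //.
by apply: measurable_funD => //; exact: measurable_powR.
Qed.

(** The nodes lie in [0, 1], where [f] is bounded by compactness, so the integrand is a bounded
    measurable function times an integrable kernel. *)
Lemma integrable_kernel_node (R : realType) (m j : nat) (eta gamma : R)
    (f : R -> R) :
  0 < eta -> 0 <= gamma -> (j <= m)%N -> continuous f ->
  (@lebesgue_measure R).-integrable `[0%R, 1%R]
    (EFin \o (fun t => frac_kernel eta t * f (node m j gamma t))).
Proof.
move=> eta0 gamma0 jm cf.
have mf : measurable_fun setT f by exact: continuous_measurable_fun.
have : bounded_set [set f u | u in `[0%R, 1%R]%classic].
  apply: compact_bounded; apply: continuous_compact; last exact: segment_compact.
  exact: continuous_subspaceT.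
move=> bf.
have -> : EFin \o (fun t => frac_kernel eta t * f (node m j gamma t)) =
  ((EFin \o (f \o node m j gamma)) \* (EFin \o frac_kernel eta))%E.
  by apply/funext => t /=; rewrite mulrC EFinM.
apply: integrableMr => //.
- by apply: (measurableT_comp mf); exact: measurable_node.
- case: bf => [M0 [M0r fM]]; exists M0; split=> // M M0M t /= t01.
  apply: fM M0M _ _ => /=.
  exists (node m j gamma t) => //; move: t01; rewrite !in_itv/=.
  exact: node_itv.
- exact: integrable_frac_kernel.
Qed.

Lemma continuous_sum_scale (R : realType) (J : Type) (r : seq J) (k : J -> R)
    (g : J -> R -> R) : (forall i, continuous (g i)) ->
  continuous (fun u => \sum_(i <- r) k i * g i u).
Proof.
move=> cg; apply: continuous_big => [|i _ u]; first exact: add_continuous.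
by apply: cvgM; [exact: cvg_cst|exact: cg].
Qed.

Lemma continuous_sqrB (R : realType) (x : R) : continuous (fun t : R => (t - x) ^+ 2).
Proof.
have cB : continuous (fun t => t - x).
  by move=> t; apply: cvgB; [exact: cvg_id|exact: cvg_cst].
by move=> t; exact: (cvgM (cB t) (cB t)).
Qed.

(** * Positivity, linearity and second central moment *)

Section op1.
Variables (R : realType) (m : nat) (eta gamma alpha : R) (s : nat) (x : R).
Hypotheses (eta0 : 0 < eta) (gamma0 : 0 < gamma).
Hypotheses (alpha01 : 0 <= alpha <= 1) (x01 : 0 <= x <= 1).
Local Notation L f := (op1 m eta gamma alpha s f x).
Local Notation q j := (q_basis alpha s m j x).
Implicit Types f g : R -> R.

Lemma q_basis_ge0 j : 0 <= q j.
Proof.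
have [[a0 a1] [x0 x1]] := (andP alpha01, andP x01).
have [a1' x1'] : 0 <= 1 - alpha /\ 0 <= 1 - x by rewrite !subr_ge0.
rewrite /q_basis; case: ifP => _; first by rewrite !mulr_ge0 ?exprn_ge0.
by rewrite !addr_ge0 ?mulr_ge0 ?exprn_ge0//; case: ifP => // _;
  rewrite ?mulr_ge0 ?exprn_ge0.
Qed.

Let sum_bernstein n :
  \sum_(0 <= j < n.+1) 'C(n, j)%:R * x ^+ j * (1 - x) ^+ (n - j) = 1.
Proof.
rewrite big_mkord -[RHS](expr1n _ n) -[X in X ^+ n](subrK x) exprDn.
by apply: eq_bigr => i _; rewrite -mulrA mulr_natl mulrC.
Qed.

(** For s <= m the three summands are Bernstein sums of degree m - s, m - s and m, the first with an
    extra factor x and the second with 1 - x. They add up to (1 - alpha) x + (1 - alpha)(1 - x) +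
    alpha. *)
Lemma sum_q_basis : \sum_(0 <= j < m.+1) q j = 1.
Proof.
rewrite /q_basis; case: ltnP => [_|sm]; first exact: sum_bernstein.
rewrite !big_split/= -big_distrr/=.
have -> : \sum_(0 <= j < m.+1) (if (s <= j)%N then
     'C(m - s, j - s)%:R * x ^+ (j - s + 1) * (1 - x) ^+ (m - j) else 0) = x.
  rewrite (@big_cat_nat _ _ _ s)//= ?leqW//.
  rewrite big_nat_cond big1 ?add0r; last first.
    by move=> j; rewrite andbT => /andP[_ /ltn_geF ->].
  rewrite -{1}(add0n s) big_addn subSn// -[RHS]mulr1.
  rewrite -[X in _ = _ * X](sum_bernstein (m - s)).
  rewrite big_distrr/=; apply: eq_bigr => j _.
  by rewrite leq_addl addnK addn1 exprS (addnC j s) subnDA; ring.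
have -> : \sum_(0 <= j < m.+1)
    (1 - alpha) * 'C(m - s, j)%:R * x ^+ j * (1 - x) ^+ (m - s - j + 1) =
    (1 - alpha) * (1 - x).
  (* Beyond j = m - s the binomial coefficient is 0, so the truncated exponent does no harm. *)
  rewrite (@big_cat_nat _ _ _ (m - s).+1)//=; last by rewrite ltnS leq_subr.
  rewrite [X in _ + X]big_nat_cond [X in _ + X]big1 ?addr0; last first.
    by move=> j; rewrite andbT => /andP[mj _]; rewrite bin_small// mulr0 !mul0r.
  rewrite -[RHS]mulr1 -[X in _ = _ * X](sum_bernstein (m - s)) big_distrr/=.
  by apply: eq_bigr => j _; rewrite addn1 exprS; ring.
have -> : \sum_(0 <= j < m.+1) alpha * 'C(m, j)%:R * x ^+ j * (1 - x) ^+ (m - j) =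
    alpha.
  rewrite -[RHS]mulr1 -[X in _ = _ * X](sum_bernstein m) big_distrr/=.
  by apply: eq_bigr => j _; rewrite !mulrA.
ring.
Qed.

Local Notation I f j := (\int[@lebesgue_measure R]_(t in `[0%R, 1%R])
  (frac_kernel eta t * f (node m j gamma t))).

Let intK f j : (j <= m)%N -> continuous f -> (@lebesgue_measure R).-integrable
  `[0%R, 1%R] (EFin \o (fun t => frac_kernel eta t * f (node m j gamma t))).
Proof. by move=> jm cf; apply: integrable_kernel_node => //; exact: ltW. Qed.

Lemma op1_cst c : L (fun=> c) = c.
Proof.
rewrite /op1; under eq_bigr => j _.
  rewrite RintegralZr//; last exact: integrable_frac_kernel.
  rewrite {1}/Rintegral integral_frac_kernel//=.
  over.
rewrite -big_distrl/= sum_q_basis mul1r mulrA divff ?mul1r//.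
by rewrite gt_eqF// Gamma_gt0// addr_gt0.
Qed.

Lemma op1_lin f g k : continuous f -> continuous g ->
  L (fun u => f u + k * g u) = L f + k * L g.
Proof.
move=> cf cg; rewrite /op1 [k * _]mulrCA -mulrDr; congr (_ * _).
rewrite big_distrr -big_split/= big_nat [RHS]big_nat; apply: eq_bigr => j.
rewrite ltnS => jm; rewrite [k * _]mulrCA -mulrDr; congr (_ * _).
rewrite -RintegralZl//; last exact: intK.
rewrite -RintegralD//; [|exact: intK|].
  by apply: eq_Rintegral => t _; ring.
exact: (integrableZl _ k (intK jm cg)).
Qed.

Lemma op1_affine c k g : continuous g -> L (fun u => c + k * g u) = c + k * L g.
Proof. by move=> cg; rewrite op1_lin ?op1_cst// => u; exact: cvg_cst. Qed.

Lemma op1_sum (J : Type) (r : seq J) (k : J -> R) (g : J -> R -> R) :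
  (forall i, continuous (g i)) ->
  L (fun u => \sum_(i <- r) k i * g i u) = \sum_(i <- r) k i * L (g i).
Proof.
move=> cg; elim: r => [|i r IHr].
  rewrite big_nil -[RHS](op1_cst 0); congr (op1 _ _ _ _ _ _ _).
  by apply/funext => u; rewrite big_nil.
rewrite big_cons -IHr addrC -op1_lin//.
  by congr (op1 _ _ _ _ _ _ _); apply/funext => u; rewrite big_cons addrC.
exact: continuous_sum_scale.
Qed.

(** The comparison is asked for on [0, 1] only, since the nodes stay there. *)
Lemma op1_le f g : continuous f -> continuous g ->
  (forall u, 0 <= u <= 1 -> f u <= g u) -> L f <= L g.
Proof.
move=> cf cg fg; apply: ler_wpM2l; first by rewrite ltW ?Gamma_gt0 ?addr_gt0.
rewrite big_nat [leRHS]big_nat; apply: ler_sum => j /=; rewrite ltnS => jm.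
rewrite ler_wpM2l ?q_basis_ge0//; apply: le_Rintegral => //; try exact: intK.
move=> t /=; rewrite in_itv/= => t01; rewrite ler_wpM2l ?frac_kernel_ge0//.
by apply/fg/node_itv => //; exact: ltW.
Qed.

(** Monotonicity applied to c - g <= f <= c + g, whose outer terms have images c - L g and c + L g
    because L fixes constants. *)
Lemma op1_dist_le f g c : continuous f -> continuous g ->
  (forall u, 0 <= u <= 1 -> `|f u - c| <= g u) -> `|L f - c| <= L g.
Proof.
move=> cf cg fg; rewrite ler_distl.
have cA k : continuous (fun u => c + k * g u).
  move=> u; apply: cvgD; first exact: cvg_cst.
  by apply: cvgM; [exact: cvg_cst|exact: cg].
have := op1_affine c (-1) cg; rewrite mulN1r => <-.
have := op1_affine c 1 cg; rewrite mul1r => <-.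
by rewrite !op1_le// => u /fg; rewrite ler_distl => /andP[? ?]; lra.
Qed.

(** Every integral is strictly positive, and the nonnegative weights have sum 1, so they cannot all
    vanish. Strictness permits division by the moment later. *)
Lemma second_central_moment_gt0 : 0 < second_central_moment m eta gamma alpha s x.
Proof.
have csq := @continuous_sqrB R x.
rewrite /second_central_moment /op1 mulr_gt0 ?Gamma_gt0 ?addr_gt0//.
have Igt0 j : (j <= m)%N -> 0 < I (fun t => (t - x) ^+ 2) j.
  move=> jm.
  have ltn (t u : R) : 0 <= t -> t < u -> node m j gamma t < node m j gamma u.
    move=> t0 tu; rewrite /node ltr_pM2r ?invr_gt0// ltrD2l.
    by rewrite gt0_ltr_powR// nnegrE// ltW// (le_lt_trans t0).
  have pos t : 0 <= t < 1 -> node m j gamma t != x ->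
      0 < frac_kernel eta t * (node m j gamma t - x) ^+ 2.
    move=> /andP[t0 t1] tx; rewrite mulr_gt0//.
      by rewrite divr_gt0 ?Gamma_gt0// powR_gt0// subr_gt0.
    by rewrite exprn_even_gt0//= subr_eq0.
  have ge0 t : 0 <= frac_kernel eta t * (node m j gamma t - x) ^+ 2.
    by rewrite mulr_ge0 ?frac_kernel_ge0// sqr_ge0.
  (* The node increases strictly with t, so it avoids x on one open half of [0, 1]; its value at 1/2
     decides which. *)
  have [xh|xh] := lerP x (node m j gamma 2^-1).
  - apply: (@Rintegral_gt0 _ _ `]2^-1, 1%R[) => //.
    + by move=> t /=; rewrite !in_itv/= => /andP[] *; apply/andP; split; lra.
    + by rewrite lebesgue_measure_itv/= lte_fin ifT ?lte_fin; lra.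
    + exact: (intK jm csq).
    + move=> t /=; rewrite in_itv/= => /andP[t0 t1]; apply: pos; first by lra.
      by rewrite gt_eqF// (le_lt_trans xh)// ltn// invr_ge0.
  - apply: (@Rintegral_gt0 _ _ `]0%R, 2^-1[) => //.
    + by move=> t /=; rewrite !in_itv/= => /andP[] *; apply/andP; split; lra.
    + by rewrite lebesgue_measure_itv/= lte_fin ifT ?lte_fin; lra.
    + exact: (intK jm csq).
    + move=> t /=; rewrite in_itv/= => /andP[t0 t1]; apply: pos; first by lra.
      by rewrite lt_eqF// (lt_trans _ xh)// ltn// ltW.
rewrite big_mkord lt_neqAle; apply/andP; split; last first.
  apply: sumr_ge0 => j _; rewrite mulr_ge0 ?q_basis_ge0// ltW// Igt0//.
  by rewrite -ltnS.
rewrite eq_sym psumr_eq0; last first.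
  move=> j _; rewrite mulr_ge0 ?q_basis_ge0// ltW// Igt0//.
  by rewrite -ltnS.
apply/negP => /allP q0.
have := sum_q_basis; rewrite big_mkord big1; first by move/eqP; rewrite eq_sym oner_eq0.
move=> j _; have /q0 : j \in index_enum 'I_m.+1 by rewrite mem_index_enum.
rewrite /= mulf_eq0 => /orP[/eqP//|].
by rewrite gt_eqF// Igt0// -ltnS.
Qed.

End op1.

(** * The modulus of continuity *)

(* Composition with the retraction [clamp01] onto [[0, 1]] extends a function
   continuous on the unit square to a continuous function on the plane. *)
Definition clamp01 {R : realType} (u : R) : R := Num.max 0 (Num.min u 1).

Lemma clamp01_itv (R : realType) (u : R) : 0 <= clamp01 u <= 1.
Proof. by rewrite /clamp01 le_max lexx ge_max ler01 ge_min lexx orbT. Qed.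

Lemma clamp01_id (R : realType) (u : R) : 0 <= u <= 1 -> clamp01 u = u.
Proof. by case/andP=> u0 u1; rewrite /clamp01 (min_idPl u1) (max_idPr u0). Qed.

Lemma continuous_clamp01 (R : realType) : continuous (@clamp01 R).
Proof.
move=> u; have cc (c : R) : {for u, continuous (fun=> c : R)} by exact: cvg_cst.
have ci : {for u, continuous (@id R)} by exact: cvg_id.
exact: (continuous_max (cc 0) (continuous_min ci (cc 1))).
Qed.

Lemma unit_squareP (R : realType) (v : R * R) :
  unit_square v <-> 0 <= v.1 <= 1 /\ 0 <= v.2 <= 1.
Proof. by rewrite /unit_square/= !in_itv/=. Qed.

Lemma continuous_comp_clamp01 (R : realType) (phi : R * R -> R) :
  {within unit_square, continuous phi} ->
  continuous (fun p => phi (clamp01 p.1, clamp01 p.2)).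
Proof.
move=> /subspace_continuousP cphi p.
have sq : unit_square (clamp01 p.1, clamp01 p.2).
  by apply/unit_squareP; split; exact: clamp01_itv.
apply: cvg_trans (cphi _ sq).
have cc : (fun p => (clamp01 p.1, clamp01 p.2)) @ p --> (clamp01 p.1, clamp01 p.2).
  have c1 : clamp01 q.1 @[q --> p] --> clamp01 p.1.
    by apply: (@cvg_comp _ _ _ fst clamp01 _ (nbhs p.1));
      [apply: cvg_fst|exact: continuous_clamp01].
  have c2 : clamp01 q.2 @[q --> p] --> clamp01 p.2.
    by apply: (@cvg_comp _ _ _ snd clamp01 _ (nbhs p.2));
      [apply: cvg_snd|exact: continuous_clamp01].
  exact: (cvg_pair c1 c2).
move=> A /= /cc cA; apply: (@filterS _ (nbhs p) _ _ _ _ cA) => q /=; apply.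
by apply/unit_squareP; split; exact: clamp01_itv.
Qed.

Section complete_modulus.
Variables (R : realType) (phi : R * R -> R).
Hypothesis cphi : {within unit_square, continuous phi}.

Lemma unit_square_bounded :
  exists2 M, 0 <= M & forall v, unit_square v -> `|phi v| <= M.
Proof.
have : bounded_set [set phi v | v in unit_square].
  apply: compact_bounded; apply: continuous_compact => //.
  by apply: compact_setX; exact: segment_compact.
case=> M0 [M0r phiM]; exists (`|M0| + 1); first by rewrite addr_ge0.
move=> v sv; apply: phiM; last by exists v.
by rewrite ltr_pwDr// ler_norm.
Qed.

(** [sup] bounds its set only if that set is bounded above, which follows from the boundedness of
    [phi] on the compact square. *)
Lemma dist_le_complete_modulus (rho1 rho2 : R) (v w : R * R) :
  unit_square v -> unit_square w -> `|v.1 - w.1| <= rho1 -> `|v.2 - w.2| <= rho2 ->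
  `|phi v - phi w| <= complete_modulus phi rho1 rho2.
Proof.
move=> sv sw d1 d2; apply: ub_le_sup; last by exists v, w.
have [M M0 phiM] := unit_square_bounded; exists (M + M) => _ [v' [w' [sv' sw' _ _ ->]]].
by rewrite (le_trans (ler_normB _ _))// lerD// phiM.
Qed.

Lemma complete_modulus_ge0 (rho1 rho2 : R) (v : R * R) :
  unit_square v -> 0 <= rho1 -> 0 <= rho2 -> 0 <= complete_modulus phi rho1 rho2.
Proof.
move=> sv r1 r2; apply: le_trans (dist_le_complete_modulus sv sv _ _) => //.
- by rewrite subrr normr0.
- by rewrite subrr normr0.
Qed.

(** The segment from [w] to [v] is cut into n+1 equal steps. Convexity keeps the points [p k] in the
    square, each step costs at most one modulus, and the differences telescope. *)
Lemma dist_le_natmul_modulus (rho1 rho2 : R) n (v w : R * R) :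
  unit_square v -> unit_square w ->
  `|v.1 - w.1| <= n.+1%:R * rho1 -> `|v.2 - w.2| <= n.+1%:R * rho2 ->
  `|phi v - phi w| <= n.+1%:R * complete_modulus phi rho1 rho2.
Proof.
move=> /unit_squareP[v1 v2] /unit_squareP[w1 w2] d1 d2.
pose c (k : nat) (a b : R) := a + k%:R / n.+1%:R * (b - a).
pose p k := (c k w.1 v.1, c k w.2 v.2).
have c01 k a b : (k <= n.+1)%N -> 0 <= a <= 1 -> 0 <= b <= 1 -> 0 <= c k a b <= 1.
  move=> kn /andP[a0 a1] /andP[b0 b1].
  have : 0 <= k%:R / n.+1%:R :> R by rewrite divr_ge0.
  have : k%:R / n.+1%:R <= 1 :> R by rewrite ler_pdivrMr// mul1r ler_nat.
  rewrite /c; move: (k%:R / _) => r r1 r0; nra.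
have sp k : (k <= n.+1)%N -> unit_square (p k).
  by move=> kn; apply/unit_squareP; split; exact: c01.
have cS k a b rho : `|b - a| <= n.+1%:R * rho -> `|c k.+1 a b - c k a b| <= rho.
  move=> ab; have -> : c k.+1 a b - c k a b = (b - a) / n.+1%:R.
    by rewrite /c -[k.+1%:R]natr1; ring.
  by rewrite normrM normfV [`|n.+1%:R|]ger0_norm// ler_pdivrMr// mulrC.
have -> : v = p n.+1.
  rewrite /p /c divff ?pnatr_eq0// !mul1r.
  by rewrite [w.1 + _]addrC [w.2 + _]addrC !subrK; case: (v).
have -> : w = p 0%N by rewrite /p /c !mul0r !addr0; case: (w).
rewrite -(@telescope_sumr _ 0 n.+1 (phi \o p))// (le_trans (ler_norm_sum _ _ _))//.
rewrite big_mkord.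
apply: (@le_trans _ _ (\sum_(k < n.+1) complete_modulus phi rho1 rho2)).
  apply: ler_sum => k _; apply: dist_le_complete_modulus.
  - exact: sp.
  - by apply: sp; rewrite ltnW.
  - exact: cS.
  - exact: cS.
by rewrite sumr_const card_ord mulr_natl.
Qed.

(* A bound quadratic in [d] rather than [1 + |d| / rho]: its mean involves only
   the second moment, so that no Cauchy-Schwarz inequality is needed. *)
Lemma exists_natmul_ge (d rho : R) : 0 < rho ->
  exists n, `|d| <= n.+1%:R * rho /\ n.+1%:R <= 1 + (rho ^+ 2)^-1 * d ^+ 2.
Proof.
move=> rho0; pose r := `|d| / rho; have r0 : 0 <= r by rewrite divr_ge0// ltW.
have r2 : (rho ^+ 2)^-1 * d ^+ 2 = r ^+ 2.
  by rewrite /r expr_div_n real_normK ?num_real// mulrC.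
(* With n the integer part of r^2, n + 1 <= 1 + r^2; and r <= n + 1, because r <= 1 or r <= r^2 < n
   + 1. *)
exists (Num.trunc (r ^+ 2)); rewrite r2.
have /andP[ler2 gtr2] := truncn_itv (sqr_ge0 r).
split; last by rewrite -natr1 addrC lerD2l.
rewrite -ler_pdivrMr// -/r; have [r1|r1] := lerP r 1.
  by rewrite (le_trans r1)// ler1n.
by apply: ltW; apply: le_lt_trans gtr2; rewrite expr2 ler_peMl// ltW.
Qed.

(** If n1+1 and n2+1 steps suffice for the two coordinates, their product suffices for both at once.
    A product bound separates the variables, so each operator can be applied to its own factor. *)
Lemma dist_le_modulus_sqr (rho1 rho2 : R) (v w : R * R) : 0 < rho1 -> 0 < rho2 ->
  unit_square v -> unit_square w ->
  `|phi v - phi w| <= complete_modulus phi rho1 rho2 *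
    (1 + (rho1 ^+ 2)^-1 * (v.1 - w.1) ^+ 2) * (1 + (rho2 ^+ 2)^-1 * (v.2 - w.2) ^+ 2).
Proof.
move=> rho10 rho20 sv sw.
have [n1 [d1 b1]] := exists_natmul_ge (v.1 - w.1) rho10.
have [n2 [d2 b2]] := exists_natmul_ge (v.2 - w.2) rho20.
have om0 := complete_modulus_ge0 sv (ltW rho10) (ltW rho20).
have Nn : (n1.+1 * n2.+1)%N = (n1.+1 * n2.+1).-1.+1 by [].
apply: le_trans (@dist_le_natmul_modulus rho1 rho2 (n1.+1 * n2.+1).-1 v w sv sw _ _) _.
- rewrite -Nn natrM (le_trans d1)// ler_wpM2r ?(ltW rho10)//.
  by rewrite ler_peMr// ler1n.
- rewrite -Nn natrM (le_trans d2)// ler_wpM2r ?(ltW rho20)//.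
  by rewrite ler_peMl// ler1n.
- rewrite -Nn natrM mulrC -mulrA; apply: ler_wpM2l => //; exact: ler_pM.
Qed.

End complete_modulus.

(** * The bivariate operator as an iterated univariate operator *)

Lemma continuous_pairl (R : realType) (h : R * R -> R) (v : R) :
  continuous h -> continuous (fun u => h (u, v)).
Proof.
move=> ch u; apply: (@cvg_comp _ _ _ (fun u : R => (u, v)) h _ (nbhs (u, v))).
  have c1 : (t : R) @[t --> u] --> u by exact: cvg_id.
  have c2 : v @[_ --> u] --> v by exact: cvg_cst.
  exact: (cvg_pair c1 c2).
exact: ch.
Qed.

Lemma continuous_pairr (R : realType) (h : R * R -> R) (u : R) :
  continuous h -> continuous (fun v => h (u, v)).
Proof.
move=> ch v; apply: (@cvg_comp _ _ _ (fun v : R => (u, v)) h _ (nbhs (u, v))).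
  have c1 : u @[_ --> v] --> u by exact: cvg_cst.
  have c2 : (t : R) @[t --> v] --> v by exact: cvg_id.
  exact: (cvg_pair c1 c2).
exact: ch.
Qed.

(** Dominated convergence with majorant [M] times the kernel, which is independent of v. *)
Lemma continuous_integral_kernel (R : realType) (m j : nat) (eta gamma M : R)
    (h : R * R -> R) :
  0 < eta -> 0 <= gamma -> (j <= m)%N -> continuous h ->
  (forall p, `|h p| <= M) ->
  continuous (fun v : R => \int[@lebesgue_measure R]_(t in `[0%R, 1%R])
    (frac_kernel eta t * h (node m j gamma t, v))).
Proof.
move=> eta0 gamma0 jm ch hM a.
have aI : a \in `]a - 1, a + 1[%classic by rewrite inE/= in_itv/=; lra.
apply: (@continuity_under_integral R _ _ (@lebesgue_measure R)
  (fun v t => frac_kernel eta t * h (node m j gamma t, v)) `[0%R, 1%R] _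
  (a - 1) (a + 1) _ _ (fun t => M * frac_kernel eta t)) => //.
- move=> v _.
  apply: (@integrable_kernel_node R m j eta gamma (fun u => h (u, v))) => //.
  exact: continuous_pairl.
- apply: aeW => t _ v _; apply: cvgM; first exact: cvg_cst.
  exact: continuous_pairr.
- exact: (integrableZl _ M (integrable_frac_kernel eta0)).
- move=> v _; apply: aeW => t _.
  rewrite normrM ger0_norm ?frac_kernel_ge0// [leRHS]mulrC.
  by rewrite ler_wpM2l ?frac_kernel_ge0.
Qed.

(** The inner integral of [op2] runs over t1, so it matches L1 placed inside L2; the clamps act as
    the identity at the nodes. Continuity of [L1] is included so that the rules for L2 apply to
    it. *)
Lemma op2_op1 (R : realType) (m1 m2 : nat)
    (eta1 eta2 gamma1 gamma2 alpha1 alpha2 : R) (s1 s2 : nat)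
    (phi : R * R -> R) (z y : R) :
  0 < eta1 -> 0 < eta2 -> 0 < gamma1 -> 0 < gamma2 ->
  0 <= alpha2 <= 1 -> 0 <= y <= 1 ->
  {within unit_square, continuous phi} ->
  let L1 v := op1 m1 eta1 gamma1 alpha1 s1
    (fun u => phi (clamp01 u, clamp01 v)) z in
  continuous L1 /\
  op2 m1 m2 eta1 eta2 gamma1 gamma2 alpha1 alpha2 s1 s2 phi z y =
    op1 m2 eta2 gamma2 alpha2 s2 L1 y.
Proof.
move=> eta10 eta20 gamma10 gamma20 alpha201 y01 cphi L1.
pose h p := phi (clamp01 p.1, clamp01 p.2).
have ch : continuous h by exact: continuous_comp_clamp01.
have [M M0 phiM] := unit_square_bounded cphi.
have hM p : `|h p| <= M.
  by apply: phiM; apply/unit_squareP; split; exact: clamp01_itv.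
pose I (j : 'I_m1.+1) (v : R) := \int[@lebesgue_measure R]_(t in `[0%R, 1%R])
  (frac_kernel eta1 t * h (node m1 j gamma1 t, v)).
pose k (j : 'I_m1.+1) := Gamma (eta1 + 1) * q_basis alpha1 s1 m1 j z.
have cI j : continuous (I j).
  by apply: continuous_integral_kernel hM => //; [exact: ltW|rewrite -ltnS].
(* A finite combination of continuous functions of v: this gives continuity and lets L2 act term by
   term. *)
have L1E : L1 = fun v => \sum_(j <- index_enum 'I_m1.+1) k j * I j v.
  apply/funext => v; rewrite /L1 /op1 big_mkord big_distrr/=.
  by apply: eq_bigr => j _; rewrite mulrA.
split; first by rewrite L1E; exact: continuous_sum_scale.
rewrite L1E op1_sum// /op2 big_mkord big_distrr/=.
apply: eq_bigr => j1 _; rewrite /op1 !big_distrr/= !big_mkord.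
apply: eq_bigr => j2 _; rewrite /k.
set X := \int[_]_(_ in _) _; set Y := \int[_]_(_ in _) _.
suff -> : X = Y by ring.
apply: eq_Rintegral => t2 /set_mem/=; rewrite in_itv/= => t201.
rewrite /I -RintegralZl//; last first.
  apply: (@integrable_kernel_node R m1 j1 eta1 gamma1
    (fun u => h (u, node m2 j2 gamma2 t2))) => //.
  - exact: ltW.
  - by rewrite -ltnS.
  - exact: continuous_pairl.
apply: eq_Rintegral => t1 /set_mem/=; rewrite in_itv/= => t101.
rewrite /h/= !clamp01_id; first by ring.
- by apply: node_itv => //; [exact: ltW|rewrite -ltnS].
- by apply: node_itv => //; [exact: ltW|rewrite -ltnS].
Qed.

(** * The estimate with constant 4 *)

Unset Implicit Arguments.

Theorem theorem7 (R : realType) (m1 m2 : nat)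
    (eta1 eta2 gamma1 gamma2 alpha1 alpha2 : R) (s1 s2 : nat)
    (phi : R * R -> R) (z y : R) :
  (0 < m1)%N -> (0 < m2)%N ->
  0 < eta1 -> 0 < eta2 ->
  0 < gamma1 -> 0 < gamma2 ->
  0 <= alpha1 <= 1 -> 0 <= alpha2 <= 1 ->
  {within unit_square, continuous phi} ->
  unit_square (z, y) ->
  `|op2 m1 m2 eta1 eta2 gamma1 gamma2 alpha1 alpha2 s1 s2 phi z y - phi (z, y)|
    <= 4 * complete_modulus phi
             (Num.sqrt (second_central_moment m1 eta1 gamma1 alpha1 s1 z))
             (Num.sqrt (second_central_moment m2 eta2 gamma2 alpha2 s2 y)).
Proof.
move=> _ _ eta10 eta20 gamma10 gamma20 alpha101 alpha201 cphi sq.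
have [/= z01 y01] := (unit_squareP (z, y)).1 sq.
set d1 := second_central_moment _ _ _ _ _ _.
set d2 := second_central_moment _ _ _ _ _ _.
have d10 : 0 < d1 by exact: second_central_moment_gt0.
have d20 : 0 < d2 by exact: second_central_moment_gt0.
have [r10 r20] : 0 < Num.sqrt d1 /\ 0 < Num.sqrt d2 by rewrite !sqrtr_gt0.
set om := complete_modulus _ _ _.
have [cL1 ->] := @op2_op1 R m1 m2 eta1 eta2 gamma1 gamma2 alpha1 alpha2 s1 s2
  phi z y eta10 eta20 gamma10 gamma20 alpha201 y01 cphi.
have cA c k x : continuous (fun t : R => c + k * (t - x) ^+ 2).
  move=> t; apply: cvgD; first exact: cvg_cst.
  by apply: cvgM; [exact: cvg_cst|exact: continuous_sqrB].
(* The mean of (t - y)^2 is [d2], so this quadratic has image 2 om + 2 om = 4 om, and the claim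
   becomes a pointwise bound in v. *)
have -> : 4 * om = op1 m2 eta2 gamma2 alpha2 s2
    (fun t => 2 * om + 2 * om / d2 * (t - y) ^+ 2) y.
  rewrite op1_affine//; last exact: continuous_sqrB.
  by rewrite -[op1 _ _ _ _ _ _ _]/d2 divfK ?gt_eqF//; ring.
apply: op1_dist_le => // v v01.
(* The part of the quadratic bound that is constant in u; the remaining factor 1 + (u - z)^2 / d1
   has mean 2 under L1, which yields 2c. *)
pose c := om * (1 + d2^-1 * (v - y) ^+ 2).
have -> : 2 * om + 2 * om / d2 * (v - y) ^+ 2 = op1 m1 eta1 gamma1 alpha1 s1
    (fun t => c + c / d1 * (t - z) ^+ 2) z.
  rewrite op1_affine//; last exact: continuous_sqrB.
  by rewrite -[op1 _ _ _ _ _ _ _]/d1 divfK ?gt_eqF// /c; ring.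
apply: op1_dist_le => //.
  exact: (@continuous_pairl R (fun p => phi (clamp01 p.1, clamp01 p.2)) v
    (continuous_comp_clamp01 cphi)).
move=> u u01; rewrite !clamp01_id//.
have suv : unit_square (u, v) by exact/unit_squareP.
apply: le_trans (dist_le_modulus_sqr cphi r10 r20 suv sq) _.
rewrite !sqr_sqrtr ?(ltW d10) ?(ltW d20)// -/om /c /=.
rewrite le_eqVlt; apply/orP; left; apply/eqP; ring.
Qed.
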